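(* Let $R$ be a (commutative) local ring and let $A$ be an artinian $R$-module. Then every injective $R$-module homomorphism $f:A\to A$ is an isomorphism. *)

(* Defs.v *)
From HB Require Import structures.
From mathcomp Require Import all_boot all_algebra.
From mathcomp Require Import boolp classical_sets.

Set Implicit Arguments.
Unset Strict Implicit.
Unset Printing Implicit Defensive.

Import GRing.Theory.
Local Open Scope classical_set_scope.
Local Open Scope ring_scope.

(* Ideals and submodules are arbitrary subsets ([set _]), viewed as MathComp
   collective predicates through the classical membership [x \in S].
   Beware that [idealr_closed] includes properness ([1 \notin S]). *)

Definition maximal_ideal (R : comNzRingType) (M : set R) : Prop :=
  idealr_closed [in M] /\
  forall J : set R, idealr_closed [in J] -> M `<=` J -> J = M.

Definition local_ring (R : comNzRingType) : Prop :=
  exists! M : set R, maximal_ideal M.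

Definition submodule (R : pzRingType) (A : lmodType R) (S : set A) : Prop :=
  submod_closed [in S].

(* Descending chain condition on submodules. *)
Definition artinian_module (R : pzRingType) (A : lmodType R) : Prop :=
  forall S : nat -> set A,
    (forall n, submodule (S n)) ->
    (forall n, S n.+1 `<=` S n) ->
    exists N, forall n, (N <= n)%N -> S n = S N.

Definition module_isomorphism (R : pzRingType) (A B : lmodType R)
    (f : {linear A -> B}) : Prop :=
  exists g : {linear B -> A}, cancel f g /\ cancel g f.

(* Main.v *)
From HB Require Import structures.
Require Import Defs.
From mathcomp Require Import all_boot all_algebra.
From mathcomp Require Import boolp classical_sets.

Local Open Scope ring_scope.

Import GRing.Theory.

(** The images of the iterates of [f] form a descending chain of submodules,
    so the images of [f^N] and [f^(N+1)] agree for some [N]. Hence for each [y]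
    there is [x] with [f^N y = f^N (f x)], and cancelling the injective [f^N]
    gives [y = f x]. *)

Lemma submodule_range_iter {R : pzRingType} {A : lmodType R}
    (f : {linear A -> A}) (n : nat) :
  submodule (range (iter n f)).
Proof.
have iterP a u v : iter n f (a *: u + v) = a *: iter n f u + iter n f v.
  by elim: n => //= n ->; rewrite linearP.
split; first by rewrite inE; exists 0 => //; elim: n {iterP} => //= n ->; rewrite linear0.
move=> a _ _ /set_mem[u _ <-] /set_mem[v _ <-].
by rewrite inE; exists (a *: u + v).
Qed.

Lemma artinian_inj_surj {R : pzRingType} {A : lmodType R}
    (f : {linear A -> A}) :
  artinian_module A -> injective f -> forall y, exists x, f x = y.
Proof.
move=> hA f_inj y.
have [n|N stable] := hA _ (submodule_range_iter f).
  (* The chain descends because [f^(n+1) x = f^n (f x)]. *)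
  by move=> _ [x _ <-]; exists (f x); rewrite -?iterSr.
have [x _] : range (iter N.+1 f) (iter N f y).
  by rewrite (stable N.+1 (leqnSn N)); exists y.
rewrite iterSr => eq_iter; exists x.
(* Injectivity strips the outermost [f] from both sides, one per induction step. *)
by elim: N eq_iter {stable} => //= N IHN /f_inj.
Qed.

(** The set-theoretic inverse of a linear map is automatically linear. *)
Lemma module_isomorphism_bij (R : pzRingType) (A B : lmodType R)
    (f : {linear A -> B}) :
  bijective f -> module_isomorphism f.
Proof.
case=> g fK gK.
pose gL := GRing.isLinear.Build R B A _ g (can2_linear fK gK).
pose g' : {linear B -> A} := HB.pack g gL.
by exists g'.
Qed.

Theorem corollary5p2 (R : comNzRingType) (A : lmodType R)
    (hR : local_ring R) (hA : artinian_module A)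
    (f : {linear A -> A}) (hf : injective f) :
  module_isomorphism f.
Proof.
apply: module_isomorphism_bij.
have [g gK] := choice (artinian_inj_surj f hA hf).
(* The chosen section [g] is also a left inverse: [f (g (f x)) = f x], and [f] is injective. *)
by exists g => // x; apply: hf.
Qed.
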